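(* Let $\mathcal{C}$ be a $d$-clutter on vertex set $[n]$, let $\mathbb{K}$ be a field, and let $I_{\overline{\mathcal{C}}} \subset R=\mathbb{K}[x_1,\dots,x_n]$ be the circuit ideal of the complement of $\mathcal{C}$. Then $\mathcal{C}$ can be obtained from the complete $d$-clutter $K_n^d$ through a (possibly empty) sequence of circuit erasures if and only if $I_{\overline{\mathcal{C}}}$ has linear quotients and $$\operatorname{pdim}(I_{\overline{\mathcal{C}}}) < n-d.$$
   Context: A $d$-clutter ($d\ge 1$) on $[n]=\{1,\dots,n\}$ is a collection $\mathcal{C}$ of $d$-element subsets of $[n]$, called circuits. The complete $d$-clutter $K_n^d$ consists of all $d$-subsets of $[n]$. The complement $\overline{\mathcal{C}}$ consists of all $d$-subsets of $[n]$ not in $\mathcal{C}$. A clique of $\mathcal{C}$ is a nonempty $S \subset [n]$ such that either $|S|<d$, or $|S|\ge d$ and every $d$-subset of $S$ is a circuit of $\mathcal{C}$; it is maximal if it is maximal under inclusion among cliques. A circuit $e\in\mathcal{C}$ is exposed if it is contained in a unique maximal clique $S$ of $\mathcal{C}$, and properly exposed if moreover $|S|>d$. A circuit erasure is the removal of a properly exposed circuit $e$, i.e. passing from $\mathcal{C}$ to $\mathcal{C}\setminus\{e\}$. For $e=\{v_1,\dots,v_d\}$, $\mathbf{x}_e = x_{v_1}\cdots x_{v_d}$, and the circuit ideal of a $d$-clutter $\mathcal{D}$ is $I_{\mathcal{D}} = \langle \mathbf{x}_f : f\in\mathcal{D}\rangle$. A monomial ideal $I$ has linear quotients if there is an ordering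 $(m_1,\dots,m_g)$ of its minimal monomial generators such that for every $j=1,\dots,g-1$ the colon ideal $(\langle m_1,\dots,m_j\rangle : m_{j+1})$ is generated by a subset of the variables (the zero ideal has linear quotients vacuously). The projective dimension of a graded ideal $I$, regarded as an $R$-module, is $\operatorname{pdim}(I)=\max\{i : \beta_i(I)\ne 0\}$, where $\beta_i(I)=\dim_{\mathbb{K}}\operatorname{Tor}_i^R(I,\mathbb{K})$; by convention $\operatorname{pdim}(0)=-\infty$. *)

(* Defs.v *)
From mathcomp Require Import all_boot all_order all_algebra.
From mathcomp Require Export mpoly.
From Stdlib Require Import Relation_Operators.

Set Implicit Arguments.
Unset Strict Implicit.
Unset Printing Implicit Defensive.

Import GRing.Theory Num.Theory.
Local Open Scope ring_scope.

(** The vertex set [n] = {1, ..., n} is represented by 'I_n. *)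

Definition is_clutter (n d : nat) (C : {set {set 'I_n}}) : Prop :=
  forall e, e \in C -> #|e| = d.

Definition complete_clutter (n d : nat) : {set {set 'I_n}} :=
  [set e : {set 'I_n} | #|e| == d].

Definition clutter_compl (n d : nat) (C : {set {set 'I_n}}) :
    {set {set 'I_n}} :=
  [set e : {set 'I_n} | (#|e| == d) && (e \notin C)].

Definition clique (n d : nat) (C : {set {set 'I_n}}) (S : {set 'I_n}) : bool :=
  (S != set0) &&
  ((#|S| < d)%N ||
   ((d <= #|S|)%N &&
    [forall e : {set 'I_n}, (e \subset S) && (#|e| == d) ==> (e \in C)])).

Definition maximal_clique (n d : nat) (C : {set {set 'I_n}}) (S : {set 'I_n}) :
    bool :=
  maxset (clique d C) S.

Definition exposed_by (n d : nat) (C : {set {set 'I_n}}) (e S : {set 'I_n}) :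
    Prop :=
  e \in C /\
  unique (fun T : {set 'I_n} => maximal_clique d C T /\ e \subset T) S.

Definition properly_exposed (n d : nat) (C : {set {set 'I_n}})
    (e : {set 'I_n}) : Prop :=
  exists2 S, exposed_by d C e S & (d < #|S|)%N.

Definition circuit_erasure (n d : nat) (C C' : {set {set 'I_n}}) : Prop :=
  exists2 e, properly_exposed d C e & C' = C :\ e.

Definition obtained_by_erasures (n d : nat) : {set {set 'I_n}} -> Prop :=
  clos_refl_trans _ (@circuit_erasure n d) (complete_clutter n d).

(** Ideals of R = K[x_1, ..., x_n] are represented by their membership
    predicates. *)

Section Ideals.
Variables (K : fieldType) (n : nat).
Local Notation R := {mpoly K[n]}.

Definition ideal_gen (s : seq R) (p : R) : Prop :=
  exists c : 'I_(size s) -> R, p = \sum_(i < size s) c i * s`_i.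

Definition ideal_colon (I : R -> Prop) (m : R) (p : R) : Prop := I (p * m).

Definition circuit_monomial (e : {set 'I_n}) : R := \prod_(v in e) 'X_v.

Definition circuit_ideal (D : {set {set 'I_n}}) : R -> Prop :=
  ideal_gen [seq circuit_monomial f | f <- enum D].

(** [(m' <= m)%MM] is divisibility of monomials (pointwise comparison of the
    exponents), not the monomial order [(m' <= m)%O]. *)
Definition minimal_monomial (I : R -> Prop) (m : 'X_{1..n}) : Prop :=
  I 'X_[m] /\ forall m' : 'X_{1..n}, (m' <= m)%MM -> I 'X_[m'] -> m' = m.

Definition has_linear_quotients (I : R -> Prop) : Prop :=
  exists ms : seq 'X_{1..n},
    [/\ uniq ms,
        (forall m, m \in ms <-> minimal_monomial I m)
      & forall j, (0 < j < size ms)%N ->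
        exists V : {set 'I_n}, forall p : R,
          ideal_colon (ideal_gen [seq 'X_[m] | m <- take j ms])
                      'X_[nth 0%MM ms j] p
          <-> ideal_gen [seq 'X_i | i <- enum V] p].

(** A resolution of an ideal [I] by free modules of finite rank,
      ... -> R^(rk 2) -> R^(rk 1) -> R^(rk 0) -> I -> 0.
    Elements of R^b are row vectors and matrices act on them on the right;
    [fr_diff i] is the map from R^(rk i.+1) to R^(rk i). *)
Record free_resolution (I : R -> Prop) := FreeResolution {
  fr_rank : nat -> nat;
  fr_aug : 'cV[R]_(fr_rank 0);
  fr_diff : forall i, 'M[R]_(fr_rank i.+1, fr_rank i);
  fr_aug_onto : forall p : R,
    I p <-> exists v : 'rV[R]_(fr_rank 0), p%:M = v *m fr_aug;
  fr_exact0 : forall v : 'rV[R]_(fr_rank 0),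
    v *m fr_aug = 0 <-> exists w, v = w *m fr_diff 0;
  fr_exactS : forall i (v : 'rV[R]_(fr_rank i.+1)),
    v *m fr_diff i = 0 <-> exists w, v = w *m fr_diff i.+1
}.

(** Since K = R / (x_1, ..., x_n), the functor (_ ⊗_R K) sends R^b to K^b and a
    matrix over R to the matrix of its constant terms. *)
Definition tensor_diff (I : R -> Prop) (F : free_resolution I) (i : nat) :
    'M[K]_(fr_rank F i.+1, fr_rank F i) :=
  map_mx (meval (fun _ : 'I_n => 0)) (fr_diff F i).

(** The i-cycles of F ⊗_R K (the augmentation being dropped). *)
Definition tensor_cycles (I : R -> Prop) (F : free_resolution I) (i : nat) :
    'M[K]_(fr_rank F i) :=
  match i with
  | 0 => 1%:M
  | j.+1 => kermx (tensor_diff F j)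
  end.

(** dim_K Tor_i^R(I, K), the i-th homology of F ⊗_R K.  The subtraction is exact:
    the row space of [tensor_diff F i] (the boundaries) is contained in that of
    [tensor_cycles F i]. *)
Definition tor_dim (I : R -> Prop) (F : free_resolution I) (i : nat) : nat :=
  (\rank (tensor_cycles F i) - \rank (tensor_diff F i))%N.

(** [b i] is the Betti number beta_i(I). *)
Definition betti_numbers (I : R -> Prop) (b : nat -> nat) : Prop :=
  exists F : free_resolution I, forall i, b i = tor_dim F i.

(** pdim(I), as the maximum of {i : beta_i(I) <> 0}; [None] stands for -oo, the
    maximum of the empty set, attained exactly when I = 0. *)
Definition is_pdim (I : R -> Prop) (p : option nat) : Prop :=
  exists2 b, betti_numbers I b &
    match p with
    | None => forall i, b i = 0%N
    | Some m => b m <> 0%N /\ forall i, b i <> 0%N -> (i <= m)%N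
    end.

End Ideals.

Arguments circuit_monomial K {n} e.
Arguments circuit_ideal K {n} D _.

(** The order on {-oo} ∪ Z. *)
Definition pdim_lt (p : option nat) (z : int) : Prop :=
  match p with
  | None => True
  | Some m => m%:Z < z
  end.

(* Main.v *)
Require Import Defs.
From HB Require Import structures.
From mathcomp Require Import all_boot all_order all_algebra zify.
From Stdlib Require Import Relation_Operators Operators_Properties.

Set Implicit Arguments.
Unset Strict Implicit.
Unset Printing Implicit Defensive.

(** Let [e_1, ..., e_t] be the circuits missing from [C], and let [V_j] be the
    set of vertices [v] outside [e_j] such that [e_j] together with [v] contains
    some earlier [e_i].  The ideal [(x_{e_1}, ..., x_{e_{j-1}}) : x_{e_j}] is
    generated by variables iff every earlier [e_i] meets [V_j], and these
    variables are then those of [V_j].  On the other hand, every clique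
    containing [e_j] in the clutter missing [e_1, ..., e_{j-1}] avoids [V_j],
    and the complement of [V_j] is a clique under that same condition.  So [e_j]
    is exposed iff the colon ideal is generated by variables, and properly
    exposed iff moreover [#|V_j| < n - d].

    It remains to see that, for linear quotients, [beta_i(I) = 0] iff
    [#|V_j| < i] for all [j].  Projecting onto the last coordinate filters the
    syzygies of [x_{e_1}, ..., x_{e_t}] by the colon ideals, and likewise those
    of a sequence of variables by ideals of variables, so repeated use of the
    horseshoe lemma yields a resolution of [I].  It is minimal because the
    matrices have no constant terms and their linear parts are nondegenerate, a
    condition which the horseshoe construction preserves.  Comparing an
    arbitrary resolution with this minimal one gives the Betti numbers. *)

Import GRing.Theory Num.Theory.
Local Open Scope ring_scope.

(** * Minimal free resolutions and the horseshoe lemma *)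

Section MinimalResolutions.
Variables (K : fieldType) (n : nat).
Local Notation R := {mpoly K[n]}.

Definition const_term : R -> K := meval (fun _ => 0).
HB.instance Definition _ := GRing.RMorphism.copy const_term (meval (fun _ => 0)).

(** The coefficient of [x_i] in [p], taken as a derivative at the origin so that the Leibniz rule
    governs products. *)
Definition linear_coef (i : 'I_n) (p : R) : K := const_term p^`M(i).

Lemma linear_coefM i p q :
  linear_coef i (p * q) =
  linear_coef i p * const_term q + const_term p * linear_coef i q.
Proof. by rewrite /linear_coef mderivM rmorphD !rmorphM. Qed.

Lemma linear_coef_is_additive i : zmod_morphism (linear_coef i).
Proof. by move=> p q; rewrite /linear_coef mderivB rmorphB. Qed.

HB.instance Definition _ i :=
  GRing.isZmodMorphism.Build R K (linear_coef i) (linear_coef_is_additive i).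

Lemma linear_coef_mulmx i a b c (A : 'M[R]_(a, b)) (B : 'M[R]_(b, c)) :
  map_mx (linear_coef i) (A *m B) =
  map_mx (linear_coef i) A *m map_mx const_term B
  + map_mx const_term A *m map_mx (linear_coef i) B.
Proof.
apply/matrixP => x y; rewrite !mxE raddf_sum -big_split.
by apply: eq_bigr => z _ /=; rewrite linear_coefM !mxE.
Qed.

(* The second condition says that [u *m A] has no linear terms only when [u] has
   no constant terms.  It makes the kernel of [A] have no constant terms and,
   unlike that property of the kernel, it passes to the block matrices of the
   horseshoe lemma. *)
Definition linearly_minimal a b (A : 'M[R]_(b, a)) : Prop :=
  map_mx const_term A = 0 /\
  forall w : 'rV[K]_b, (forall i, w *m map_mx (linear_coef i) A = 0) -> w = 0.

(** As [A] has no constant terms, the linear part of [v *m A] is the constant part of [v] times the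
    linear part of [A]. *)
Lemma linearly_minimal_ker a b (A : 'M[R]_(b, a)) (v : 'rV_b) :
  linearly_minimal A -> v *m A = 0 -> map_mx const_term v = 0.
Proof.
move=> [A0 Amin] vA0; apply: Amin => i.
by have := linear_coef_mulmx i v A; rewrite vA0 A0 mulmx0 add0r map_mx0.
Qed.

(* The resolution vanishes from step [k] on, and its ranks are given by [r]. *)
Fixpoint min_res k a (M : 'rV[R]_a -> Prop) (r : nat -> nat) : Prop :=
  match k with
  | 0 => (forall v, M v <-> v = 0) /\ (forall i, r i = 0%N)
  | k'.+1 => exists A : 'M[R]_(r 0%N, a),
      [/\ linearly_minimal A, forall v, M v <-> exists w, v = w *m A
        & min_res k' (fun w : 'rV_(r 0%N) => w *m A = 0) (fun i => r i.+1)]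
  end.

Lemma eq_min_res k a (M M' : 'rV[R]_a -> Prop) r :
  (forall v, M v <-> M' v) -> min_res k M r -> min_res k M' r.
Proof.
move=> eM; case: k => [|k] /= => [[M0 r0]|[A [Amin MA rA]]].
  by split=> // v; rewrite -eM.
by exists A; split=> // v; rewrite -eM.
Qed.

Lemma mulmx_lift a b c (M : 'rV[R]_a -> Prop) (A : 'M[R]_(b, a))
    (X : 'M[R]_(c, a)) :
  (forall v, M v -> exists w, v = w *m A) -> (forall i, M (row i X)) ->
  exists Y, X = Y *m A.
Proof.
move=> MA XM; have [f Ef] := fin_all_exists (fun i => MA _ (XM i)).
by exists (\matrix_i f i); apply/row_matrixP => i; rewrite row_mul rowK.
Qed.

(* The submodule ker (col_mx B2 B1) is an extension of its projection to the
   first [a2] coordinates by ker B1. *)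
Lemma horseshoe k : forall a1 a2 c (B1 : 'M[R]_(a1, c)) (B2 : 'M[R]_(a2, c))
    r1 r2,
  (forall v : 'rV_(a2 + a1), v *m col_mx B2 B1 = 0 ->
     map_mx const_term v = 0) ->
  min_res k (fun u => u *m B1 = 0) r1 ->
  min_res k (fun v => exists u, v *m B2 + u *m B1 = 0) r2 ->
  min_res k (fun v => v *m col_mx B2 B1 = 0) (fun i => r2 i + r1 i)%N.
Proof.
elim: k => [|k IHk] a1 a2 c B1 B2 r1 r2 Mm.
  move=> [M1 r10] [M2 r20]; split=> [v|i]; last by rewrite r10 r20.
  split=> [|->]; last by rewrite mul0mx.
  rewrite -[v]hsubmxK mul_row_col => v0.
  have v20 : lsubmx v = 0 by apply/M2; exists (rsubmx v).
  have v10 : rsubmx v = 0 by apply/M1; rewrite -v0 v20 mul0mx add0r.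
  by rewrite v20 v10 row_mx0.
move=> [A1 [A1min M1 res1]] [A2 [A2min M2 res2]].
(* Each row of [A2] lies in the projection, so it extends to a syzygy; [C] collects the remaining
   coordinates. *)
have [C AC] : exists C, A2 *m B2 + C *m B1 = 0.
  have [i|f Ef] :=
    fin_all_exists (P := fun i u => row i A2 *m B2 + u *m B1 = 0).
    by apply/M2; exists (delta_mx 0 i); rewrite rowE.
  exists (\matrix_i f i); apply/row_matrixP => i.
  by rewrite linearD /= !row_mul rowK Ef row0.
have A1B1 : A1 *m B1 = 0.
  apply/row_matrixP => i; rewrite row_mul row0; apply/M1.
  by exists (delta_mx 0 i); rewrite rowE.
have C0 : map_mx const_term C = 0.
  apply/row_matrixP => i; rewrite row0 -map_row.
  have/Mm: row_mx (row i A2) (row i C) *m col_mx B2 B1 = 0.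
    by rewrite mul_row_col -!row_mul -linearD /= AC row0.
  by rewrite map_row_mx -row_mx0 => /eq_row_mx[].
exists (block_mx A2 C 0 A1).
have Amin : linearly_minimal (block_mx A2 C 0 A1).
  case: A1min A2min => [A10 A1min] [A20 A2min]; split=> [|w].
    by rewrite map_block_mx A10 A20 C0 map_mx0 block_mx0.
  rewrite -[w]hsubmxK => w0.
  have e i : lsubmx w *m map_mx (linear_coef i) A2 = 0 /\
      lsubmx w *m map_mx (linear_coef i) C
      + rsubmx w *m map_mx (linear_coef i) A1 = 0.
    have := w0 i; rewrite map_block_mx mul_row_block.
    by rewrite map_mx0 mulmx0 addr0 -row_mx0 => /eq_row_mx[].
  have w20 : lsubmx w = 0 by apply: A2min => i; have [] := e i.
  rewrite w20 [rsubmx w]A1min ?row_mx0 // => i.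
  by have [_] := e i; rewrite w20 mul0mx add0r.
split=> // [v|].
  split=> [|[w ->]]; last first.
    rewrite -mulmxA block_mxEv mul_col_mx !mul_row_col AC mul0mx add0r A1B1.
    by rewrite col_mx0 mulmx0.
  rewrite -[v]hsubmxK mul_row_col => v0.
  have [|w2 v2] := (M2 (lsubmx v)).1; first by exists (rsubmx v).
  (* Subtracting the combination [w2] of the rows of [row_mx A2 C] from [v] leaves an element of the
     kernel of [B1]. *)
  have [|w1 v1] := (M1 (rsubmx v - w2 *m C)).1.
    have: w2 *m (A2 *m B2 + C *m B1) = 0 by rewrite AC mulmx0.
    rewrite mulmxDr !mulmxA -v2 => e.
    have := congr2 (fun x y => x - y) v0 e.
    by rewrite opprD addrACA subrr add0r subr0 -mulmxBl.
  exists (row_mx w2 w1); rewrite mul_row_block mulmx0 addr0 -v2 -v1.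
  by rewrite addrC subrK.
(* The new kernel has the same shape, with [row_mx A2 C] and [row_mx 0 A1] in place of [B2] and
   [B1]. *)
rewrite block_mxEv.
apply: IHk => [v v0||]; first by apply: linearly_minimal_ker v0.
  apply: eq_min_res res1 => u; rewrite mul_mx_row mulmx0.
  split=> [->|]; first by rewrite row_mx0.
  by rewrite -[0 in RHS]row_mx0 => /eq_row_mx[].
(* The projection is the whole kernel of [A2]: for [v] in it, [v *m C] is killed by [B1], hence
   lifts through [A1]. *)
apply: eq_min_res res2 => v; split=> [v0|[u]].
  have [|w vC] := (M1 (v *m C)).1.
    have := congr1 (mulmx v) AC.
    by rewrite mulmxDr !mulmxA v0 mul0mx add0r mulmx0.
  exists (- w); rewrite !mul_mx_row mulmx0 v0 vC mulNmx add_row_mx addr0 subrr.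
  by rewrite row_mx0.
by rewrite !mul_mx_row add_row_mx mulmx0 addr0 -row_mx0 => /eq_row_mx[].
Qed.

End MinimalResolutions.

(** * Syzygies of a sequence of polynomials *)

Section LinearQuotients.
Variables (K : fieldType) (n : nat).
Local Notation R := {mpoly K[n]}.

Definition gens (s : seq R) : 'cV[R]_(size s) := \col_i s`_i.

Lemma ideal_genE (s : seq R) p :
  ideal_gen s p <-> exists v : 'rV_(size s), p%:M = v *m gens s.
Proof.
split=> [[c ->]|[v /matrixP/(_ 0 0)]]; last first.
  rewrite !mxE eqxx mulr1n => ->; exists (v 0) => /=.
  by apply: eq_bigr => i _; rewrite mxE.
exists (\row_i c i); apply/matrixP => i j; rewrite !ord1 !mxE eqxx mulr1n.
by apply: eq_bigr => l _; rewrite !mxE.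
Qed.

Lemma gens_cons m (s : seq R) :
  gens (m :: s) = col_mx (m%:M : 'M_1) (gens s).
Proof.
apply/matrixP => i j; rewrite !ord1 !mxE.
case: splitP => l /= ->; rewrite !mxE; last by rewrite add1n.
by rewrite !ord1 eqxx mulr1n.
Qed.

Lemma min_res0 k a (M : 'rV[R]_a -> Prop) :
  (forall v, M v <-> v = 0) -> min_res k M (fun=> 0%N).
Proof.
elim: k a M => [|k IHk] a M M0 //=.
exists 0; split=> [|v|]; last by apply: IHk => v; rewrite thinmx0 mul0mx.
  by split=> [|w _]; [rewrite map_mx0 | rewrite thinmx0].
by rewrite M0; split=> [->|[w ->]]; [exists 0; rewrite mulmx0 | rewrite mulmx0].
Qed.

Lemma syz_min_res k (s : seq R) (q : nat -> nat) :
  (forall v : 'rV_(size s), v *m gens s = 0 ->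
     map_mx (@const_term K n) v = 0) ->
  (forall i, (i < size s)%N -> exists2 r,
     min_res k (fun v : 'rV_1 => ideal_gen (drop i.+1 s) (v 0 0 * s`_i)) r &
     forall l, r l = 0%N <-> (q i <= l)%N) ->
  exists2 r, min_res k (fun v : 'rV_(size s) => v *m gens s = 0) r &
    forall l, r l = 0%N <-> forall i, (i < size s)%N -> (q i <= l)%N.
Proof.
elim: s q => [|m s IHs] q min colon.
  exists (fun=> 0%N) => //; apply: min_res0 => v; rewrite thinmx0.
  by rewrite mul0mx.
have [v v0|i lt_is|r1 res1 r1E] := IHs (fun i => q i.+1).
(* Padded with zero, a syzygy of [s] is one of [m :: s], so [min] is inherited. *)
- have e : (row_mx 0 v : 'rV_(1 + size s)) *m gens (m :: s) =
      (0 : 'rV_1) *m (m%:M : 'M_1) + v *m gens s.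
    by rewrite gens_cons; exact: mul_row_col.
  move: e; rewrite mul0mx add0r v0 => /min e.
  have: map_mx (@const_term K n) (row_mx (0 : 'rV_1) v) = 0 by exact: e.
  by rewrite map_row_mx -row_mx0 => /eq_row_mx[].
- exact: colon i.+1 lt_is.
have [r2 res2 r2E] := colon 0%N isT.
exists (fun i => r2 i + r1 i)%N => [|l].
  rewrite gens_cons in min *.
  apply: (@horseshoe K n k (size s) 1 1 (gens s) m%:M) => //.
  apply: eq_min_res res2 => v; rewrite drop1 /= ideal_genE.
  have -> : v *m (m%:M : 'M_1) = (v 0 0 * m)%:M.
    by rewrite {1}[v]mx11_scalar -scalar_mxM.
  split=> [[u ->]|[u e]]; first by exists (- u); rewrite mulNmx subrr.
  by exists (- u); rewrite mulNmx; apply/eqP; rewrite -addr_eq0 e.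
split=> [/eqP|qle].
  rewrite addn_eq0 => /andP[/eqP/r2E q0 /eqP/r1E qS] [|i] //; exact: qS.
apply/eqP; rewrite addn_eq0; apply/andP; split; apply/eqP.
  by apply/r2E/qle.
by apply/r1E => i; apply: (qle i.+1).
Qed.

(** * Membership in monomial ideals *)

Lemma ideal_gen0 (s : seq R) : ideal_gen s 0.
Proof. by exists (fun=> 0); rewrite big1 // => i _; rewrite mul0r. Qed.

Lemma ideal_genD (s : seq R) p q :
  ideal_gen s p -> ideal_gen s q -> ideal_gen s (p + q).
Proof.
move=> [c ->] [c' ->]; exists (fun i => c i + c' i); rewrite -big_split.
by apply: eq_bigr => i _; rewrite mulrDl.
Qed.

Lemma ideal_genM (s : seq R) p q : ideal_gen s q -> ideal_gen s (p * q).
Proof.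
move=> [c ->]; exists (fun i => p * c i); rewrite mulr_sumr.
by apply: eq_bigr => i _; rewrite mulrA.
Qed.

Lemma mem_ideal_gen (s : seq R) p : p \in s -> ideal_gen s p.
Proof.
move=> ps; have lt_is : (index p s < size s)%N by rewrite index_mem.
exists (fun i => (i == Ordinal lt_is)%:R).
rewrite (bigD1 (Ordinal lt_is)) //= eqxx mul1r nth_index //.
by rewrite big1 ?addr0 // => i /negPf->; rewrite mul0r.
Qed.

Lemma monomial_idealP (ms : seq 'X_{1..n}) (p : R) :
  ideal_gen [seq 'X_[m] | m <- ms] p <->
  {in msupp p, forall m, exists2 m', m' \in ms & (m' <= m)%MM}.
Proof.
split=> [[c ->] m|supp].
  move/msupp_sum_le => /flatten_mapP[i _].
  have lt_i : (i < size ms)%N by rewrite -(size_map (fun m => 'X_[m] : R)).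
  rewrite (nth_map 0%MM) //.
  rewrite (perm_mem (msuppMX _ _)) => /mapP[m' _ ->].
  by exists (nth 0%MM ms i); rewrite ?mem_nth ?lem_addr.
rewrite [p]mpolyE big_seq; elim/big_ind: _ => [||m /supp[m' m's le_m'm]].
- exact: ideal_gen0.
- exact: ideal_genD.
rewrite -mul_mpolyC; apply: ideal_genM.
rewrite -[m](submK le_m'm) mpolyXD; apply: ideal_genM.
by apply: mem_ideal_gen; apply: map_f.
Qed.

Lemma monomial_idealX (ms : seq 'X_{1..n}) m :
  ideal_gen [seq 'X_[m] | m <- ms] ('X_[m] : R) <->
  exists2 m', m' \in ms & (m' <= m)%MM.
Proof.
rewrite monomial_idealP msuppX; split=> [|e m1]; first by apply; rewrite inE.
by rewrite inE => /eqP->.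
Qed.

Lemma const_termE (p : R) : const_term p = p@_0.
Proof.
rewrite [in RHS](mpolyE p) raddf_sum /const_term mevalE; apply: eq_bigr => m _.
rewrite /= mcoeffZ mcoeffX; congr (_ * _).
have [->|] := eqVneq m 0%MM.
  by rewrite big1 // => i _; rewrite mnm0E expr0.
rewrite -mdeg_eq0 mdegE sum_nat_eq0 negb_forall => /existsP[i /=].
by move=> mi; rewrite (bigD1 i) //= expr0n (negPf mi) mul0r.
Qed.

(** In the relation given by [v], the coefficient of the [j]-th monomial is the constant term of the
    [j]-th coordinate, since no other generator divides that monomial. *)
Lemma monomial_syz (ms : seq 'X_{1..n}) :
  uniq ms -> {in ms &, forall m m', (m <= m')%MM -> m = m'} ->
  forall v : 'rV_(size [seq 'X_[m] : R | m <- ms]),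
    v *m gens [seq 'X_[m] | m <- ms] = 0 ->
    map_mx (@const_term K n) v = 0.
Proof.
move=> ums anti v v0; apply/matrixP => i j; rewrite ord1 !mxE.
have lt_s (l : 'I_(size [seq 'X_[m] : R | m <- ms])) : (l < size ms)%N.
  by rewrite -(size_map (fun m => 'X_[m] : R)).
pose mj := nth 0%MM ms j.
have := congr1 (fun M : 'M_1 => (M 0 0)@_mj) v0; rewrite /= !mxE mcoeff0.
rewrite raddf_sum (bigD1 j) //= big1 ?addr0 => [|l neq_lj].
  rewrite mxE (nth_map 0%MM) ?lt_s // -[mj in mcoeff mj _]addm0 mcoeffMX.
  by rewrite const_termE.
rewrite mxE (nth_map 0%MM) ?lt_s //; apply/eqP; rewrite mcoeff_eq0.
rewrite (perm_mem (msuppMX _ _)); apply: contra neq_lj => /mapP[m' _ e].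
apply/eqP/val_inj/eqP; rewrite /= -(nth_uniq 0%MM _ _ ums) ?lt_s //.
by apply/eqP/anti; rewrite ?mem_nth ?lt_s // -/mj e lem_addr.
Qed.

(** * Ideals of variables, and resolutions from linear quotients *)

Definition vars (V : seq 'I_n) : seq R := [seq 'X_i | i <- V].

Lemma varsE V : vars V = [seq 'X_[m] | m <- [seq U_(i)%MM | i <- V]].
Proof. by rewrite -map_comp. Qed.

Lemma linear_coefX (i j : 'I_n) : linear_coef i ('X_j : R) = (i == j)%:R.
Proof.
rewrite /linear_coef mderivX mnm1E const_termE mcoeffZ mcoeffX.
rewrite [in RHS]eq_sym; have [->|] := eqVneq j i; last by rewrite mul0r.
rewrite mul1r; suff -> : (U_(i) - U_(i))%MM = 0%MM by rewrite eqxx.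
by apply/mnmP => l; rewrite mnmBE subnn mnm0E.
Qed.

Lemma nth_vars x0 V i : (i < size V)%N -> (vars V)`_i = 'X_(nth x0 V i).
Proof. exact: nth_map. Qed.

Lemma linearly_minimal_vars V : uniq V -> linearly_minimal (gens (vars V)).
Proof.
case: V => [|x0 V'].
  by split=> [|w _]; [rewrite [gens _]flatmx0 map_mx0 | rewrite thinmx0].
move: (x0 :: V') => V uV.
have lt_V (l : 'I_(size (vars V))) : (l < size V)%N.
  by rewrite -(size_map (fun i => 'X_i : R)).
split=> [|w w0]; apply/matrixP => i j.
  by rewrite !mxE (nth_vars x0) // /const_term mevalXU.
have := congr1 (fun M : 'M_1 => M 0 0) (w0 (nth x0 V j)).
rewrite !mxE (bigD1 j) //= big1 => [|l neq_lj].
  rewrite !mxE (nth_vars x0) // linear_coefX eqxx mulr1 addr0 !ord1.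
  by move->.
rewrite !mxE (nth_vars x0) // linear_coefX nth_uniq //.
by rewrite (inj_eq val_inj) eq_sym (negPf neq_lj) mulr0.
Qed.

(** A variable other than [x_i] that divides [x_i m] already divides [m]. *)
Lemma colon_vars V i p : i \notin V ->
  ideal_gen (vars V) (p * 'X_i) <-> ideal_gen (vars V) p.
Proof.
move=> iV; rewrite varsE !monomial_idealP; split=> supp m.
  move=> mp; have [|_ /mapP[j jV ->] le_j] := supp (U_(i) + m)%MM.
    by rewrite mcoeff_msupp mcoeffMX -mcoeff_msupp.
  exists U_(j)%MM; first exact: map_f.
  apply/mnm_lepP => l; have/mnm_lepP/(_ l) := le_j.
  rewrite mnmDE !mnm1E; case: eqVneq => // <-.
  by case: eqVneq iV => [->|_ _]; [rewrite jV | rewrite add0n].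
rewrite (perm_mem (msuppMX _ _)) => /mapP[m' /supp[m1 m1V le1] ->].
exists m1 => //; apply: lepm_trans le1 _; exact: lem_addl.
Qed.

(** By [colon_vars], the colon of each variable by the later ones is the ideal of the later ones, so
    induction on [k] resolves every colon ideal that [syz_min_res] requires. *)
Lemma vars_min_res k V : uniq V -> (size V <= k)%N -> exists2 r,
  min_res k (fun v : 'rV_1 => ideal_gen (vars V) (v 0 0)) r &
  forall l, r l = 0%N <-> (size V <= l)%N.
Proof.
elim: k V => [|k IHk] V uV.
  rewrite leqn0 size_eq0 => /eqP->; exists (fun=> 0%N) => //.
  split=> // v; split=> [[c e]|->]; last by rewrite mxE; apply: ideal_gen0.
  by apply/matrixP => i j; rewrite !ord1 e big_ord0 mxE.
move=> leV.
have [||r res rE] :=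
  @syz_min_res k (vars V) (fun i => size V - i.+1)%N.
- by move=> v; apply: linearly_minimal_ker; apply: linearly_minimal_vars.
- move=> i; rewrite size_map => lt_i.
  have x0 : 'I_n by case: (V) lt_i => // x0.
  have [||r res rE] := IHk (drop i.+1 V); first exact: drop_uniq.
    by rewrite size_drop leq_subLR (leq_trans leV) // addSn ltnS leq_addl.
  exists r => [|l]; last by rewrite rE size_drop.
  apply: eq_min_res res => v; rewrite (nth_vars x0) // /vars -map_drop.
  have: nth x0 V i \notin drop i.+1 V.
    have := uV; rewrite -{1}(cat_take_drop i V) cat_uniq (drop_nth x0) //=.
    by case/and3P=> _ _ /andP[].
  by move/colon_vars->.
exists (fun i => if i is j.+1 then r j else size (vars V)) => [|[|l]].
- exists (gens (vars V)); split=> // [|v]; first exact: linearly_minimal_vars.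
  by rewrite ideal_genE -mx11_scalar.
- by rewrite leqn0 size_map; split=> /eqP.
(* The largest threshold is [size V - 1], at [i = 0]; prepending the generators shifts it to
   [size V]. *)
rewrite rE size_map; split=> [le_V|le_V i _]; last first.
  by rewrite leq_subLR addSn (leq_trans le_V) // ltnS leq_addl.
by case: (size V) le_V => // s /(_ 0%N isT); rewrite subn1.
Qed.

(** Unrolls the recursive predicate into indexed maps; beyond step [k] all ranks are zero, so zero
    maps are exact there. *)
Lemma min_res_maps k a (M : 'rV[R]_a -> Prop) r : min_res k M r ->
  exists (D0 : 'M[R]_(r 0%N, a)) (D : forall i, 'M[R]_(r i.+1, r i)),
  [/\ forall v, M v <-> exists w, v = w *m D0,
      forall v : 'rV_(r 0%N), v *m D0 = 0 <-> exists w, v = w *m D 0%N,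
      forall i (v : 'rV_(r i.+1)), v *m D i = 0 <-> exists w, v = w *m D i.+1,
      map_mx (@const_term K n) D0 = 0
    & forall i, map_mx (@const_term K n) (D i) = 0].
Proof.
elim: k a M r => [|k IHk] a M r /= => [[M0 r0]|].
  have r00 i (v : 'rV[R]_(r i)) : v = 0.
    by apply/matrixP => x y; have := ltn_ord y; rewrite {2}r0.
  exists 0, (fun=> 0); split=> [v|v|i v||i]; rewrite ?map_mx0 //.
  - rewrite M0; split=> [->|[w ->]]; last by rewrite mulmx0.
    by exists 0; rewrite mulmx0.
  - by rewrite mulmx0 [v]r00; split=> // _; exists 0; rewrite mulmx0.
  - by rewrite mulmx0 [v]r00; split=> // _; exists 0; rewrite mulmx0.
move=> [A [[A0 _] MA /IHk[D0 [D [kerA exD0 exD D00 Dmin]]]]].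
exists A, (fun i => match i return 'M[R]_(r i.+1, r i) with
                    | 0 => D0 | j.+1 => D j end).
by split=> // [[|i]|[|i]].
Qed.

(** The syzygies sit one degree above the generators of [I], so the condition [#|V j| <= l] for the
    ideal of [V j] becomes [#|V j| < i] with [i = l + 1]. *)
Lemma linear_quotients_resolution (I : R -> Prop) (ms : seq 'X_{1..n})
    (V : nat -> {set 'I_n}) :
  (forall p, I p <-> ideal_gen [seq 'X_[m] | m <- ms] p) ->
  uniq ms -> {in ms &, forall m m', (m <= m')%MM -> m = m'} ->
  (forall j, (j < size ms)%N -> forall p : R,
     ideal_colon (ideal_gen [seq 'X_[m] | m <- take j ms])
       'X_[nth 0%MM ms j] p <->
     ideal_gen (vars (enum (V j))) p) ->
  exists2 G : free_resolution I,
    forall i, tensor_diff G i = 0 &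
    forall i, fr_rank G i = 0%N <->
      forall j, (j < size ms)%N -> (#|V j| < i)%N.
Proof.
move=> IE ums anti colon.
(* The reversal turns earlier generators into later entries, by which [syz_min_res] takes colons. *)
pose s := [seq 'X_[K, m] | m <- rev ms].
have ideal_rev (t : seq 'X_{1..n}) p :
    ideal_gen [seq 'X_[K, m] | m <- rev t] p <->
    ideal_gen [seq 'X_[K, m] | m <- t] p.
  rewrite !monomial_idealP; split=> supp m /supp[m' m't le];
    by exists m'; rewrite // mem_rev in m't *.
have [||r res rE] :=
  @syz_min_res n s (fun i => #|V (size ms - i.+1)%N|).
- apply: monomial_syz; rewrite ?rev_uniq // => m m'.
  by rewrite !mem_rev; apply: anti.
- move=> i; rewrite size_map size_rev => lt_i.
  (* There are only [n] variables, so [n] steps suffice for every [j]. *)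
  have [||r res rE] := @vars_min_res n (enum (V (size ms - i.+1)%N)).
  + exact: enum_uniq.
  + by rewrite -cardE -[X in (_ <= X)%N]card_ord max_card.
  exists r => [|l]; last by rewrite rE -cardE.
  apply: eq_min_res res => v.
  rewrite /s (nth_map 0%MM) ?size_rev // nth_rev // -map_drop drop_rev.
  rewrite ideal_rev -colon //.
  by rewrite ltn_subrL /=; exact: leq_ltn_trans lt_i.
have [D0 [D [exaug ex0 exS D00 Dmin]]] := min_res_maps res.
pose rk i := if i is j.+1 then r j else size s.
pose dif i : 'M[R]_(rk i.+1, rk i) :=
  match i with 0 => D0 | j.+1 => D j end.
have onto p : I p <-> exists v : 'rV_(rk 0%N), p%:M = v *m gens s.
  by rewrite IE -ideal_rev ideal_genE.
exists (@FreeResolution K n _ rk (gens s) dif onto exaug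
  (fun i => match i with 0 => ex0 | j.+1 => exS j end)) => [[|i]|[|i]].
- exact: D00.
- exact: Dmin.
- rewrite /= /rk size_map size_rev; split=> [->//|].
  by case: (size ms) => // t /(_ 0%N isT).
rewrite /= rE size_map size_rev; split=> le_V j lt_j; last first.
  rewrite -ltnS; apply: le_V; rewrite ltn_subrL /=.
  exact: leq_ltn_trans lt_j.
have := le_V (size ms - j.+1)%N.
rewrite subnSK // subKn; last exact: ltnW.
by rewrite ltnS; apply; apply: leq_subr.
Qed.

(** * Comparison of two free resolutions *)

Lemma exact_lift (I : R -> Prop) (F : free_resolution I) i c
    (X : 'M[R]_(c, fr_rank F i.+1)) :
  X *m fr_diff F i = 0 -> exists Y, X = Y *m fr_diff F i.+1.
Proof.
move=> X0.
apply: (mulmx_lift (M := fun v => v *m fr_diff F i = 0)) => [v /fr_exactS//|j].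
by rewrite -row_mul X0 row0.
Qed.

Lemma exact_lift0 (I : R -> Prop) (F : free_resolution I) c
    (X : 'M[R]_(c, fr_rank F 0%N)) :
  X *m fr_aug F = 0 -> exists Y, X = Y *m fr_diff F 0%N.
Proof.
move=> X0.
apply: (mulmx_lift (M := fun v => v *m fr_aug F = 0)) => [v /fr_exact0//|j].
by rewrite -row_mul X0 row0.
Qed.

Lemma diff_diff (I : R -> Prop) (F : free_resolution I) i :
  fr_diff F i.+1 *m fr_diff F i = 0.
Proof.
apply/row_matrixP => j; rewrite row_mul row0; apply/fr_exactS.
by exists (delta_mx 0 j); rewrite rowE.
Qed.

Lemma diff_aug (I : R -> Prop) (F : free_resolution I) :
  fr_diff F 0%N *m fr_aug F = 0.
Proof.
apply/row_matrixP => j; rewrite row_mul row0; apply/fr_exact0.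
by exists (delta_mx 0 j); rewrite rowE.
Qed.

Lemma aug_lift (I : R -> Prop) (F G : free_resolution I) :
  exists X, fr_aug G = X *m fr_aug F.
Proof.
have [v /(fr_aug_onto F)[w e]|j|X ->] := @mulmx_lift K n _ _ _
  (fun v : 'rV_1 => I (v 0 0)) (fr_aug F) (fr_aug G).
- by exists w; rewrite -e -mx11_scalar.
- by apply/(fr_aug_onto G); exists (delta_mx 0 j); rewrite -mx11_scalar -rowE.
- by exists X.
Qed.

(* [phi] and [psi] are the i-th components of comparison maps between F and G,
   and [N + h *m d] is the homotopy between their composite and the identity. *)
Lemma comparison_maps (I : R -> Prop) (F G : free_resolution I) i :
  (forall j, tensor_diff G j = 0) ->
  exists (phi : 'M[R]_(fr_rank G i, fr_rank F i))
         (psi : 'M[R]_(fr_rank F i, fr_rank G i)),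
  [/\ exists Q, fr_diff G i *m phi = Q *m fr_diff F i,
      exists Q, fr_diff F i *m psi = Q *m fr_diff G i,
      (map_mx (@const_term K n) phi <= tensor_cycles F i)%MS
    & exists N h, [/\ phi *m psi = 1%:M + N + h *m fr_diff G i,
        fr_diff G i *m N = 0 & map_mx (@const_term K n) N = 0]].
Proof.
move=> Gmin; elim: i => [|i [phi [psi [[Q eQ] [Q' eQ'] _ [N [h [e dN N0]]]]]]].
  have [phi ephi] := aug_lift F G; have [psi epsi] := aug_lift G F.
  exists phi, psi; split.
  - by apply: exact_lift0; rewrite -mulmxA -ephi diff_aug.
  - by apply: exact_lift0; rewrite -mulmxA -epsi diff_aug.
  - exact: submx1.
  have [|h eh] := @exact_lift0 _ G _ (phi *m psi - 1%:M).
    by rewrite mulmxBl mul1mx -mulmxA -epsi -ephi subrr.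
  exists 0, h; split; rewrite ?mulmx0 ?map_mx0 //.
  by rewrite addr0 -eh addrC subrK.
(* The next comparison maps are the factors through which the previous ones commute with the
   differentials. *)
exists Q, Q'; split.
- by apply: exact_lift; rewrite -mulmxA -eQ mulmxA diff_diff mul0mx.
- by apply: exact_lift; rewrite -mulmxA -eQ' mulmxA diff_diff mul0mx.
- apply/sub_kermxP; rewrite /tensor_diff -map_mxM /= -eQ map_mxM.
  by have := Gmin i; rewrite /tensor_diff => ->; rewrite mul0mx.
have [|h' eh] := @exact_lift _ G i _ (Q *m Q' - (1%:M + fr_diff G i *m h)).
  rewrite mulmxBl -mulmxA -eQ' mulmxA -eQ -mulmxA e mulmxDl mul1mx !mulmxDr.
  by rewrite mulmx1 dN addr0 mulmxA subrr.
(* The part of the homotopy coming from the previous degree has no constant terms, because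
   [fr_diff G i] has none. *)
exists (fr_diff G i *m h), h'; split.
- by rewrite -eh addrC subrK.
- by rewrite mulmxA diff_diff mul0mx.
by rewrite map_mxM; have := Gmin i; rewrite /tensor_diff => ->; rewrite mul0mx.
Qed.

(** Modulo the variables, [phi] followed by [psi] is the identity. But [phi] lands in cycles, which
    are boundaries when the homology vanishes, and [psi] sends boundaries to boundaries of [G],
    which are zero. So the identity is zero. *)
Lemma minimal_resolution_rank (I : R -> Prop) (F G : free_resolution I) i :
  (forall j, tensor_diff G j = 0) -> tor_dim F i = 0%N -> fr_rank G i = 0%N.
Proof.
move=> Gmin /eqP; rewrite subn_eq0 => le_rank.
have bdry : (tensor_diff F i <= tensor_cycles F i)%MS.
  case: i {le_rank} => [|i]; first exact: submx1.
  by apply/sub_kermxP; rewrite /tensor_diff -map_mxM diff_diff map_mx0.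
have cyc : (tensor_cycles F i <= tensor_diff F i)%MS.
  by rewrite (geq_leqif (mxrank_leqif_sup bdry)) in le_rank.
have [phi [psi [_ [Q eQ] phiZ [N [h [e _ N0]]]]]] := comparison_maps F i Gmin.
have /submxP[W eW] := submx_trans phiZ cyc.
have := congr1 (map_mx (@const_term K n)) e.
rewrite !map_mxD !map_mxM N0 addr0 eW -mulmxA /tensor_diff.
rewrite -[map_mx (meval _) _ *m _]map_mxM eQ map_mxM map_mx1.
have := Gmin i; rewrite /tensor_diff /const_term => ->; rewrite !mulmx0 addr0.
move/(congr1 mxrank); rewrite mxrank0 mxrank1.
by move->.
Qed.

End LinearQuotients.

(** * Squarefree monomials, cliques and colon ideals *)

Section SquarefreeMonomials.
Variable n : nat.
Implicit Types (e f g : {set 'I_n}) (s : seq {set 'I_n}).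

Definition set_mnm f : 'X_{1..n} := [multinom (i \in f : nat) | i < n].

Lemma set_mnm_le f g : (set_mnm f <= set_mnm g)%MM = (f \subset g).
Proof.
apply/mnm_lepP/subsetP => [le i|sub i].
  by have := le i; rewrite !mnmE => + fi; rewrite fi lt0b.
by rewrite !mnmE; case: (boolP (i \in f)) => // /sub ->.
Qed.

Lemma set_mnm_inj : injective set_mnm.
Proof.
by move=> f g e; apply/eqP; rewrite eqEsubset -!set_mnm_le e lepm_refl.
Qed.

Lemma circuit_idealE (K : fieldType) (D : {set {set 'I_n}}) :
  circuit_ideal K D =
  ideal_gen [seq 'X_[m] | m <- [seq set_mnm f | f <- enum D]].
Proof.
rewrite /circuit_ideal -map_comp; congr ideal_gen; apply: eq_map => f /=.
rewrite mpolyXE_id /circuit_monomial big_mkcond; apply: eq_bigr => i _.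
by rewrite mnmE; case: (i \in f).
Qed.

(** The set [V_j], for [e = e_j] and [s] the list of earlier circuits. *)
Definition blockers s e : {set 'I_n} :=
  [set v | (v \notin e) && has (fun f => f \subset v |: e) s].

Definition covered_by_blockers s e : Prop :=
  {in s, forall f, exists2 v, v \in f & v \in blockers s e}.

Variable d : nat.

Lemma clique_mem (C : {set {set 'I_n}}) S f :
  clique d C S -> (d <= #|S|)%N -> f \subset S -> #|f| = d -> f \in C.
Proof.
case/andP=> _ /orP[|/andP[_ /forallP/(_ f)/implyP Sf] _ fS fd].
  by rewrite ltnNge => /negP.
by apply: Sf; rewrite fS fd /=.
Qed.

(** The complement [S] of the blockers contains every clique through [e]. Each [v] in [S] makes
    [v |: e] a clique, so a unique maximal clique through [e] must be all of [S]. Finally, [S] is a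
    clique iff no member of [s] lies in it, that is, iff each one meets the blockers. *)
Lemma properly_exposedP (C : {set {set 'I_n}}) s e :
  (0 < d)%N -> (forall f, (f \in C) = (#|f| == d) && (f \notin s)) ->
  {in s, forall f, #|f| = d} -> e \in C ->
  properly_exposed d C e <->
    covered_by_blockers s e /\ (#|blockers s e| < n - d)%N.
Proof.
move=> d_gt0 CE sd eC; have /andP[/eqP ed eNs] : (#|e| == d) && (e \notin s).
  by rewrite -CE.
pose S := ~: blockers s e.
have eS : e \subset S.
  by apply/subsetP => v ve; rewrite !inE ve.
have cardS : (#|blockers s e| = n - #|S|)%N.
  by rewrite cardsCs card_ord.
have cliqueS (T : {set 'I_n}) : clique d C T -> e \subset T -> T \subset S.
  move=> cT eT; apply/subsetP => v vT; rewrite !inE negb_and negbK.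
  case: (boolP (v \in e)) => //= ve; apply/hasPn => f fs; apply/negP => fve.
  have: f \in C.
    apply: clique_mem cT _ _ (sd _ fs); first by rewrite -ed subset_leq_card.
    by apply: subset_trans fve _; rewrite subUset sub1set vT.
  by rewrite CE fs andbF.
split=> [[S' [_ [[/maxsetP[cS' maxS'] eS'] S'uniq]] ltS']|[cov lt]].
  have eqS : S' = S.
    apply/eqP; rewrite eqEsubset cliqueS //; apply/subsetP => v vS.
    have cv : clique d C (v |: e).
      apply/andP; split; first by apply/set0Pn; exists v; rewrite setU11.
      apply/orP; right; apply/andP; split.
        by rewrite -ed subset_leq_card ?subsetUr.
      apply/forallP => f; apply/implyP => /andP[fve fd].
      rewrite CE fd /=; apply: contraL vS => fs; rewrite !inE negbK.
      apply/andP; split; last by apply/hasP; exists f.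
      (* If [v] were in [e], then [f] would be a subset of [e] of the same size, putting [e] in
         [s]. *)
      apply: contra eNs => ve; suff -> : e = f by [].
      apply/eqP; rewrite eq_sym eqEcard ed (eqP fd) leqnn andbT.
      by move: fve; rewrite (setUidPr _) // sub1set.
    have [T maxT vT] := maxset_exists cv.
    have eT : e \subset T := subset_trans (subsetUr _ _) vT.
    by rewrite (S'uniq T) // (subsetP vT) ?setU11.
  split; last first.
    have := max_card S'; rewrite card_ord cardS -eqS; lia.
  move=> f fs; have fNS : ~~ (f \subset S).
    apply/negP => fS; have: f \in C.
      apply: clique_mem cS' _ _ (sd _ fs); first exact: ltnW.
      by rewrite eqS.
    by rewrite CE fs andbF.
  have /subsetPn[v vf] := fNS; rewrite !inE negbK => vB.
  by exists v; rewrite ?inE.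
have cS : clique d C S.
  apply/andP; split.
    by rewrite -card_gt0 (leq_trans d_gt0) // -ed subset_leq_card.
  apply/orP; right; rewrite -{1}ed subset_leq_card //=.
  apply/forallP => f; apply/implyP => /andP[fS fd]; rewrite CE fd /=.
  apply/negP => /cov[v vf]; have := subsetP fS v vf.
  by rewrite in_setC => /negPf->.
exists S; last by have := max_card S; rewrite card_ord; lia.
split=> //; split=> [|T [/maxsetP[cT maxT] eT]]; last first.
  by apply: maxT => //; apply: cliqueS.
by split=> //; apply/maxsetP; split=> // T cT ST; apply/eqP;
  rewrite eqEsubset ST cliqueS // (subset_trans eS).
Qed.

Variable K : fieldType.
Let X f : {mpoly K[n]} := 'X_[set_mnm f].

Lemma mem_blockers s e v :
  {in e :: s, forall f, #|f| = d} -> e \notin s ->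
  (exists2 f, f \in s & (set_mnm f <= U_(v) + set_mnm e)%MM) <->
  v \in blockers s e.
Proof.
move=> sd eNs; rewrite inE.
have le_sub f : (set_mnm f <= U_(v) + set_mnm e)%MM -> f \subset v |: e.
  move/mnm_lepP => le; apply/subsetP => i fi; have := le i.
  rewrite !inE mnmDE mnm1E !mnmE fi (eq_sym v).
  by case: (i == v) => //; case: (i \in e).
split=> [[f fs le]|/andP[ve /hasP[f fs fve]]].
  apply/andP; split; last by apply/hasP; exists f => //; apply: le_sub.
  apply: contra eNs => ve; suff -> : e = f by [].
  apply/eqP; rewrite eq_sym eqEcard !sd ?inE ?eqxx ?fs ?orbT // leqnn andbT.
  by have := le_sub _ le; rewrite (setUidPr _) // sub1set.
exists f => //; apply/mnm_lepP => i; rewrite mnmDE mnm1E !mnmE.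
case: (boolP (i \in f)) => // /(subsetP fve).
by rewrite !inE (eq_sym v); case: (i == v) => //=; case: (i \in e).
Qed.

Lemma colonXP s e p :
  ideal_colon (ideal_gen [seq X f | f <- s]) (X e) p <->
  {in msupp p, forall m, exists2 f, f \in s & (set_mnm f <= m + set_mnm e)%MM}.
Proof.
rewrite /ideal_colon [[seq X f | f <- s]](map_comp (fun m => 'X_[m]) set_mnm).
rewrite monomial_idealP; split=> supp m.
  move=> mp; have [|_ /mapP[f fs ->] le] := supp (set_mnm e + m)%MM.
    by rewrite mcoeff_msupp mcoeffMX -mcoeff_msupp.
  by exists f; rewrite // addmC.
rewrite (perm_mem (msuppMX _ _)) => /mapP[m' /supp[f fs le] ->].
by exists (set_mnm f); rewrite ?map_f // addmC.
Qed.

Lemma varsP (V : {set 'I_n}) (p : {mpoly K[n]}) :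
  ideal_gen (vars K (enum V)) p <->
  {in msupp p, forall m, exists2 v, v \in V & (U_(v) <= m)%MM}.
Proof.
rewrite varsE monomial_idealP; split=> supp m /supp[].
  by move=> _ /mapP[v + ->] le; rewrite mem_enum => vV; exists v.
by move=> v vV le; exists U_(v)%MM; rewrite ?map_f ?mem_enum.
Qed.

Lemma lem_U (v : 'I_n) (m : 'X_{1..n}) : (U_(v) <= m)%MM = (0 < m v)%N.
Proof.
apply/mnm_lepP/idP => [/(_ v)|mv i]; rewrite mnm1E ?eqxx //.
by case: eqVneq => // <-.
Qed.

(** If [x_f] divides [m x_e], a blocker [v] in [f] lies outside [e], so [x_v] divides [m];
    conversely each blocker is in the colon ideal by [mem_blockers]. *)
Lemma colon_blockers s e :
  {in e :: s, forall f, #|f| = d} -> e \notin s -> covered_by_blockers s e ->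
  forall p, ideal_colon (ideal_gen [seq X f | f <- s]) (X e) p <->
            ideal_gen (vars K (enum (blockers s e))) p.
Proof.
move=> sd eNs cov p; rewrite colonXP varsP; split=> supp m /supp[].
  move=> f fs /mnm_lepP le; have [v vf vB] := cov f fs; exists v => //.
  rewrite lem_U; have := le v; rewrite mnmDE !mnmE vf.
  by move: vB; rewrite inE => /andP[/negPf-> _]; rewrite addn0.
move=> v /(mem_blockers v sd eNs)[f fs le] lev; exists f => //.
apply: lepm_trans le _; apply/mnm_lepP => i.
by rewrite !mnmDE leq_add2r; apply: (mnm_lepP lev).
Qed.

(** The monomial of [f :\: e] is in the colon ideal, so a variable of [V] divides it; that variable
    is itself in the colon ideal, hence a blocker in [f]. *)
Lemma colon_vars_blockers s e (V : {set 'I_n}) :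
  {in e :: s, forall f, #|f| = d} -> e \notin s ->
  (forall p, ideal_colon (ideal_gen [seq X f | f <- s]) (X e) p <->
             ideal_gen (vars K (enum V)) p) ->
  covered_by_blockers s e.
Proof.
move=> sd eNs colon f fs.
have /colon/varsP : ideal_colon (ideal_gen [seq X f | f <- s]) (X e)
    'X_[set_mnm (f :\: e)].
  apply/colonXP => m; rewrite msuppX inE => /eqP->; exists f => //.
  apply/mnm_lepP => i; rewrite mnmDE !mnmE in_setD.
  by case: (i \in e); case: (i \in f).
case/(_ (set_mnm (f :\: e))) => [|v vV]; first by rewrite msuppX inE.
rewrite lem_U mnmE lt0b in_setD => /andP[_ vf]; exists v => //.
apply/(mem_blockers v sd eNs).
have /colon/colonXP : ideal_gen (vars K (enum V)) 'X_v.
  apply/varsP => m; rewrite msuppX inE => /eqP->; exists v => //.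
  exact: lepm_refl.
by apply; rewrite msuppX inE.
Qed.

End SquarefreeMonomials.

(** * Erasure sequences as orderings of the missing circuits *)

Section Erasures.
Variables n d : nat.

Definition erase (s : seq {set 'I_n}) : {set {set 'I_n}} :=
  [set f in complete_clutter n d | f \notin s].

Lemma eraseE s f : (f \in erase s) = (#|f| == d) && (f \notin s).
Proof. by rewrite !inE. Qed.

Lemma erase_rcons s e : erase (rcons s e) = erase s :\ e.
Proof.
by apply/setP => f; rewrite in_setD1 !eraseE mem_rcons in_cons negb_or andbCA.
Qed.

Definition erasure_order (s : seq {set 'I_n}) : Prop :=
  forall j, (j < size s)%N ->
    properly_exposed d (erase (take j s)) (nth set0 s j).

Lemma erasure_order_obtained s :
  erasure_order s -> obtained_by_erasures d (erase s).
Proof.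
move=> ers; rewrite -[s]take_size.
elim: {-2}(size s) (leqnn (size s)) => [|j IHj] lt_j.
  rewrite take0; suff -> : erase [::] = complete_clutter n d by apply: rt_refl.
  by apply/setP => f; rewrite !inE andbT.
apply: rt_trans (IHj (ltnW lt_j)) _; apply: rt_step.
exists (nth set0 s j); first exact: ers.
by rewrite (take_nth set0 lt_j) erase_rcons.
Qed.

Lemma obtained_erasure_order (C : {set {set 'I_n}}) :
  obtained_by_erasures d C ->
  exists s : seq {set 'I_n},
    [/\ uniq s, {in s, forall f : {set 'I_n}, #|f| = d}, erasure_order s &
        C = erase s].
Proof.
(* In this form of the closure the last erasure is split off, matching [rcons]. *)
move=> obt; have {obt} := clos_rt_rtn1 _ _ _ _ obt.
elim=> [|C1 C2 [e exp ->] _ [s [us sd ers C1E]]].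
  by exists [::]; split=> //; apply/setP => f; rewrite !inE andbT.
have eC : e \in erase s by rewrite -C1E; case: exp => S [].
have /andP[/eqP ed eNs] : (#|e| == d) && (e \notin s) by rewrite -eraseE.
exists (rcons s e); split.
- by rewrite rcons_uniq eNs.
- by move=> f; rewrite mem_rcons inE => /predU1P[->|/sd].
- move=> j; rewrite size_rcons ltnS leq_eqVlt => /orP[/eqP->|lt_j].
    by rewrite nth_rcons ltnn eqxx -cats1 take_size_cat // -C1E.
  rewrite nth_rcons lt_j -cats1 takel_cat ?(ltnW lt_j) //; exact: ers.
- by rewrite erase_rcons C1E.
Qed.

End Erasures.

(** * The circuit ideal and the equivalence *)

Section CircuitIdeal.
Variables (K : fieldType) (n d : nat).

(** Circuits of equal size are never properly contained in one another, so every generator is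
    minimal. *)
Lemma minimal_monomial_circuitP (D : {set {set 'I_n}}) m :
  {in D, forall f : {set 'I_n}, #|f| = d} ->
  minimal_monomial (circuit_ideal K D) m <->
  exists2 f, f \in D & m = set_mnm f.
Proof.
move=> Dd.
have memI (m' : 'X_{1..n}) : circuit_ideal K D 'X_[m'] <->
    exists2 f, f \in D & (set_mnm f <= m')%MM.
  rewrite circuit_idealE monomial_idealX; split=> -[g].
    by case/mapP=> f; rewrite mem_enum => fD -> le; exists f.
  by move=> gD le; exists (set_mnm g); rewrite ?map_f ?mem_enum.
split=> [[/memI[f fD le] min]|[f fD ->]].
  exists f; rewrite // -(min _ le) //.
  by apply/memI; exists f; rewrite ?lepm_refl.
split=> [|m' le /memI[g gD leg]].
  by apply/memI; exists f; rewrite ?lepm_refl.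
have eg : g = f.
  apply/eqP; rewrite eqEcard -set_mnm_le (lepm_trans leg) //.
  by rewrite (Dd f) ?(Dd g) /=.
apply/mnmP => i; apply/eqP; rewrite eqn_leq (mnm_lepP le) /=.
by rewrite -eg (mnm_lepP leg).
Qed.

Lemma tor_dim_minimal (I : {mpoly K[n]} -> Prop) (G : free_resolution I) i :
  (forall j, tensor_diff G j = 0) -> tor_dim G i = fr_rank G i.
Proof.
move=> Gmin; rewrite /tor_dim Gmin mxrank0 subn0.
by case: i => [|i] /=; rewrite ?mxrank1 // mxrank_ker Gmin mxrank0 subn0.
Qed.

Lemma circuit_resolution (D : {set {set 'I_n}}) (s : seq {set 'I_n}) :
  uniq s -> s =i D -> {in s, forall f : {set 'I_n}, #|f| = d} ->
  (forall j, (j < size s)%N -> covered_by_blockers (take j s) (nth set0 s j)) ->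
  exists2 G : free_resolution (circuit_ideal K D),
    forall i, tensor_diff G i = 0 &
    forall i, fr_rank G i = 0%N <-> forall j, (j < size s)%N ->
      (#|blockers (take j s) (nth set0 s j)| < i)%N.
Proof.
move=> us sD sd cov.
pose ms := [seq set_mnm f | f <- s].
have [|||j lt_j p|G Gmin Grk] := @linear_quotients_resolution K n
  (circuit_ideal K D) ms (fun j => blockers (take j s) (nth set0 s j)).
- move=> p; rewrite circuit_idealE !monomial_idealP.
  by split=> supp m /supp[_ /mapP[f fs ->] le]; exists (set_mnm f) => //;
    rewrite map_f //; move: fs; rewrite mem_enum sD.
- by rewrite map_inj_uniq //; apply: set_mnm_inj.
- move=> _ _ /mapP[f fs ->] /mapP[g gs ->]; rewrite set_mnm_le => fg.
  by congr set_mnm; apply/eqP; rewrite eqEcard fg (sd f) ?(sd g) /=.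
- rewrite size_map in lt_j; rewrite /ms (nth_map set0) // -map_take -map_comp.
  apply: (@colon_blockers _ d); last exact: cov.
    move=> f; rewrite inE => /predU1P[->|/mem_take]; last exact: sd.
    by apply: sd; apply: mem_nth.
  have := us; rewrite -{1}(cat_take_drop j s) cat_uniq (drop_nth set0) //=.
  by case/and3P=> _ /norP[].
by exists G => // i; rewrite Grk size_map.
Qed.

End CircuitIdeal.

Theorem proposition3p7 (K : fieldType) (n d : nat) (hd : (0 < d)%N)
    (C : {set {set 'I_n}}) (hC : is_clutter d C) :
  obtained_by_erasures d C <->
  (has_linear_quotients (circuit_ideal K (clutter_compl d C)) /\
   exists2 p : option nat,
     is_pdim (circuit_ideal K (clutter_compl d C)) p &
     pdim_lt p (n%:Z - d%:Z)).
Proof.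
pose D := clutter_compl d C; rewrite -/D.
have Dd : {in D, forall f : {set 'I_n}, #|f| = d}.
  by move=> f; rewrite inE => /andP[/eqP].
have nth_facts (s : seq {set 'I_n}) j :
    uniq s -> {in s, forall f : {set 'I_n}, #|f| = d} -> (j < size s)%N ->
    [/\ nth set0 s j \in erase d (take j s),
        nth set0 s j \notin take j s
      & {in nth set0 s j :: take j s, forall f : {set 'I_n}, #|f| = d}].
  move=> us sd lt_j.
  have eNs : nth set0 s j \notin take j s.
    have := us; rewrite -{1}(cat_take_drop j s) cat_uniq (drop_nth set0) //=.
    by case/and3P=> _ /norP[].
  rewrite eraseE eNs sd ?mem_nth // eqxx; split=> // f.
  by rewrite inE => /predU1P[->|/mem_take /sd]; rewrite // sd ?mem_nth.
have exposedE (s : seq {set 'I_n}) j :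
    uniq s -> {in s, forall f : {set 'I_n}, #|f| = d} -> (j < size s)%N ->
    properly_exposed d (erase d (take j s)) (nth set0 s j) <->
    covered_by_blockers (take j s) (nth set0 s j) /\
    (#|blockers (take j s) (nth set0 s j)| < n - d)%N.
  move=> us sd lt_j; have [eC eNs ed] := nth_facts s j us sd lt_j.
  apply: properly_exposedP => // [f|f fs]; first exact: eraseE.
  by apply: ed; rewrite inE fs orbT.
split=> [/obtained_erasure_order[s [us sd ers CE]]|[[ms [ums msE colon]]]].
  have sD : s =i D.
    move=> f; rewrite inE CE eraseE; case: (boolP (f \in s)) => [/sd->|].
      by rewrite eqxx.
    by case: (#|f| == d).
  have cov j lt_j := ((exposedE s j us sd lt_j).1 (ers j lt_j)).1.
  have [G Gmin Grk] := circuit_resolution K us sD sd cov.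
  split.
    exists [seq set_mnm f | f <- s]; split.
    - by rewrite map_inj_uniq //; apply: set_mnm_inj.
    - move=> m; rewrite (minimal_monomial_circuitP K m Dd).
      split=> [/mapP[f]|[f fD ->]]; last by rewrite map_f // sD.
      by rewrite sD => fD ->; exists f.
    move=> j; rewrite size_map => /andP[_ lt_j].
    exists (blockers (take j s) (nth set0 s j)) => p.
    have [_ eNs ed] := nth_facts s j us sd lt_j.
    rewrite (nth_map set0) // -map_take -map_comp.
    by apply: (colon_blockers (d := d)) => //; apply: cov.
  have tor i := tor_dim_minimal i Gmin.
  have Gn i : (n - d <= i)%N -> fr_rank G i = 0%N.
    move=> le_i; apply/Grk => j lt_j; apply: leq_trans le_i.
    by have [] := (exposedE s j us sd lt_j).1 (ers j lt_j).
  (* With no circuit missing the ideal is zero, whence [None]; otherwise degree 0 has nonzero rank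
     and all ranks vanish from [n - d] on, so a maximum exists. *)
  have [s0|s_gt0] := posnP (size s).
    exists None => //; exists (tor_dim G); first by exists G.
    by move=> i; rewrite tor; apply/Grk => j; rewrite s0.
  have ex0 : exists i, fr_rank G i != 0%N.
    by exists 0%N; apply/eqP => /Grk/(_ 0%N s_gt0).
  have bound i : fr_rank G i != 0%N -> (i <= n - d)%N.
    by move=> rk_i; rewrite leqNgt; apply: contra rk_i => /ltnW/Gn->.
  case: (ex_maxnP ex0 bound) => m rk_m max_m.
  exists (Some m).
    exists (tor_dim G); first by exists G.
    by split=> [|i]; rewrite tor; [apply/eqP | move/eqP/max_m].
  (* This truncated inequality forces [d < n], so it agrees with the one over the integers. *)
  have : (m < n - d)%N by rewrite ltnNge; apply: contra rk_m => /Gn/eqP.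
  rewrite /=; lia.
move=> [p [b [F bE] pE] lt_p].
(* The minimal generators are squarefree, so their supports recover the missing circuits in
   order. *)
pose s := [seq [set i | m i != 0%N] | m : 'X_{1..n} <- ms].
have msD m : m \in ms -> exists2 f, f \in D & m = set_mnm f.
  by move/msE/(minimal_monomial_circuitP K _ Dd).
have set_mnmK : cancel (@set_mnm n) (fun m => [set i | m i != 0%N]).
  by move=> f; apply/setP => i; rewrite inE mnmE eqb0 negbK.
have mss : ms = [seq set_mnm f | f <- s].
  rewrite /s -map_comp -[LHS]map_id; apply/eq_in_map => m /msD[f _ ->] /=.
  by rewrite set_mnmK.
have us : uniq s by move: ums; rewrite mss => /map_uniq.
have sD : s =i D.
  move=> f; rewrite -(mem_map (@set_mnm_inj n)) -mss; apply/idP/idP.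
    by move/msD => [g gD /set_mnm_inj ->].
  by move=> fD; apply/msE/(minimal_monomial_circuitP K _ Dd); exists f.
have sd : {in s, forall f : {set 'I_n}, #|f| = d}.
  by move=> f; rewrite sD => /Dd.
have cov j : (j < size s)%N -> covered_by_blockers (take j s) (nth set0 s j).
  (* Linear quotients say nothing at [j = 0], where no earlier circuit has to be covered. *)
  case: j => [_ f|j lt_j]; first by rewrite take0.
  have [_ eNs ed] := nth_facts s j.+1 us sd lt_j.
  have [|V] := colon j.+1; first by rewrite mss size_map.
  rewrite mss (nth_map set0) // -map_take -map_comp.
  exact: (colon_vars_blockers ed eNs).
have [G Gmin Grk] := circuit_resolution K us sD sd cov.
have b0 : b (n - d)%N = 0%N.
  apply/eqP; apply/negPn/negP => /eqP bn; case: p pE lt_p => [m|] //= [_ max_m].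
  by move: (max_m _ bn); lia.
(* The vanishing of the single rank in degree [n - d] bounds all the sets of blockers at once. *)
have /Grk small := minimal_resolution_rank Gmin (etrans (esym (bE _)) b0).
suff -> : C = erase d s.
  apply: erasure_order_obtained => j lt_j.
  by apply/exposedE => //; split; [apply: cov | apply: small].
apply/setP => f; rewrite eraseE sD inE; case: (boolP (f \in C)) => [/hC->|].
  by rewrite eqxx.
by case: (#|f| == d).
Qed.
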